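(* There exist a countable Markov map $T$ with inverse branches $(f_i)_{i\in\mathbb N}$ and a sequence of countable Markov maps $T_k$, $k\in\mathbb N$, with inverse branches $(f_{i,k})_{i\in\mathbb N}$ of the same orientation as $T$, such that (0) $-\log|T'|$ has summable variations; (1) there exists $0<t<1$ with $\sum_{i=1}^\infty|f_i[0,1]|^t<\infty$; (2) $\sup_{k\in\mathbb N}\sum_{n=1}^\infty\mathrm{var}_n(-\log|T_k'|)<\infty$; (3) for every $i\in\mathbb N$, $f_{i,k}\to f_i$ pointwise on $[0,1]$ as $k\to\infty$; and such that, if $\mu$ and $\mu_k$ denote the absolutely continuous invariant probability measures of $T$ and $T_k$ respectively, then $h(\mu,T)<\infty$ but $$\lim_{k\to\infty}h(\mu_k,T_k)=\infty .$$
   Context: A countable Markov map $T:[0,1]\to[0,1]$ is given by inverse branches $f_i:[0,1]\to[0,1]$, $i\in\mathbb N=\{1,2,\dots\}$, which are $C^1$ and strictly monotone, and satisfy one of the following two conditions (the orientation): - decreasing case: all $f_i$ are strictly decreasing, $f_1(0)=1$, $f_{i+1}(0)=f_i(1)$ for all $i$, and $f_i(0)$ decreases to $0$ as $i\to\infty$; - increasing case: all $f_i$ are strictly increasing, $f_1(1)=1$, $f_{i+1}(1)=f_i(0)$ for all $i$, and $f_i(1)$ decreases to $0$ as $i\to\infty$. Moreover there exist $m\in\mathbb N$ and $\xi<1$ (depending on $T$) with $|(f_{i_1}\circ\cdots\circ f_{i_m})'(x)|\le\xi$ for all $(i_1,\dots,i_m)\in\mathbb N^m$ and $x\in(0,1)$.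 The map is $T(x)=f_i^{-1}(x)$ for $x\in f_i([0,1))$ and $T(0)=0$ (and $T(1)=1$ in the increasing case). $|f_i[0,1]|$ is the length of the interval $f_i([0,1])$. Let $\Sigma=\mathbb N^{\mathbb N}$ with left shift $\sigma$, let $[\mathbf i]\subset\Sigma$ be the cylinder of sequences starting with the finite word $\mathbf i$, and let $\pi_T(i_1,i_2,\dots)=\lim_{n\to\infty}f_{i_1}\circ\cdots\circ f_{i_n}(0)$. The potential $-\log|T'|$ is regarded as the function on $\Sigma$ given by $\phi(\mathbf i)=-\log|T'(\pi_T(\mathbf i))|=\log|f_{i_1}'(\pi_T(\sigma\mathbf i))|$ (assumed finite). For $n\ge1$, $\mathrm{var}_n(\phi)=\sup_{\mathbf i\in\mathbb N^n}\sup\{|\phi(\mathbf j)-\phi(\mathbf k)|:\mathbf j,\mathbf k\in[\mathbf i]\}$, and $\phi$ has summable variations if $\sum_{n\ge1}\mathrm{var}_n(\phi)<\infty$. The entropy of a $T$-invariant probability measure $\mu$ is $h(\mu,T)=\lim_{n\to\infty}\frac1n\sum_{\mathbf i\in\mathbb N^n}-\mu(I^T_{\mathbf i})\log\mu(I^T_{\mathbf i})\in[0,\infty]$, where $I^T_{\mathbf i}=\pi_T[\mathbf i]$. The value $h(\mu_k,T_k)=\infty$ is allowed for individual $k$. *)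

(* Defs.v *)
From HB Require Import structures.
From mathcomp Require Import all_boot all_order all_algebra.
From mathcomp Require Import all_classical all_reals all_analysis.

Set Implicit Arguments.
Unset Strict Implicit.
Unset Printing Implicit Defensive.

Import Order.TTheory GRing.Theory Num.Theory.
Import numFieldNormedType.Exports.

#[global] Open Scope classical_set_scope.
#[global] Open Scope ring_scope.

(* Maps of [0,1] are total functions R -> R of which only the values on [0,1]
   matter.  The index set {1,2,...} of the branches is moved to nat, so that
   [f i] is the branch usually written f_{i+1}. *)

Section C1_on_unit_interval.
Context {R : realType}.
Implicit Type g : R -> R.

(* Derivative relative to [0,1]: one-sided at 0 and at 1. *)
Definition diff_quot g (x y : R) : R := (g y - g x) / (y - x).

Definition deriv01 g (x : R) : R :=
  lim (diff_quot g x y @[y --> within `[0, 1] x^']).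

Definition C1_01 g : Prop :=
  (forall x : R, x \in `[0, 1] ->
     cvg (diff_quot g x y @[y --> within `[0, 1] x^'])) /\
  {within `[0, 1], continuous (deriv01 g)}.

End C1_on_unit_interval.

Inductive orientation := Decreasing | Increasing.

Section markov_map.
Context {R : realType}.
Implicit Types (f : nat -> R -> R) (T : R -> R) (s : nat -> nat).

Definition oriented (o : orientation) f : Prop :=
  match o with
  | Decreasing =>
      [/\ forall i, {in `[0, 1] &, {homo f i : x y /~ x < y}},
          f 0%N 0 = 1,
          forall i, f i.+1 0 = f i 1,
          decreasing_seq (fun i => f i 0) &
          f i 0 @[i --> \oo] --> (0 : R)]
  | Increasing =>
      [/\ forall i, {in `[0, 1] &, {homo f i : x y / x < y}},
          f 0%N 1 = 1,
          forall i, f i.+1 1 = f i 0,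
          decreasing_seq (fun i => f i 1) &
          f i 1 @[i --> \oo] --> (0 : R)]
  end.

Definition branch_comp f (w : seq nat) : R -> R :=
  foldr (fun i g => f i \o g) id w.

Definition uniformly_contracting f : Prop :=
  exists (m : nat) (xi : R), [/\ (0 < m)%N, xi < 1 &
    forall (w : m.-tuple nat) (x : R), x \in `]0, 1[ ->
      `|derive1 (branch_comp f w) x| <= xi].

Record countable_markov_map (o : orientation) f T : Prop := {
  branch_range : forall i (x : R), x \in `[0, 1] -> f i x \in `[0, 1] ;
  branch_C1 : forall i, C1_01 (f i) ;
  branch_oriented : oriented o f ;
  branch_contracting : uniformly_contracting f ;
  map_branch : forall i (y : R), y \in `[0, 1[ -> T (f i y) = y ;
  map_at0 : T 0 = 0 ;
  map_at1 : o = Increasing -> T 1 = 1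
}.

Definition left_shift s : nat -> nat := fun n => s n.+1.

Definition cylinder n (w : n.-tuple nat) : set (nat -> nat) :=
  [set s | forall j : 'I_n, s j = tnth w j].

Definition coding f s : R := limn (fun n => branch_comp f (mkseq s n) 0).

(* - log |T'| read on sequences, in terms of the inverse branches. *)
Definition potential f s : R :=
  ln `|deriv01 (f (s 0%N)) (coding f (left_shift s))|.

(* [ln 0] is 0 here, so finiteness of the potential has to be stated apart. *)
Definition potential_finite f : Prop :=
  forall s, deriv01 (f (s 0%N)) (coding f (left_shift s)) != 0.

Definition var_n (phi : (nat -> nat) -> R) (n : nat) : \bar R :=
  ereal_sup [set ereal_sup [set (`|phi p.1 - phi p.2|)%:E
                           | p in cylinder w `*` cylinder w]
            | w in [set: n.-tuple nat]].

Definition sum_of_variations (phi : (nat -> nat) -> R) : \bar R :=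
  (\sum_(1 <= n <oo) var_n phi n)%E.

Definition summable_variations phi : Prop := (sum_of_variations phi < +oo)%E.

Definition branch_length f (i : nat) : \bar R :=
  lebesgue_measure (f i @` `[0, 1]).

(* Probabilities on [0,1] are Borel probabilities on R that charge only [0,1]. *)
Definition acip T (mu : probability (measurableTypeR R) R) : Prop :=
  [/\ mu `[0, 1]%classic = 1%E,
      mu `<< lebesgue_measure &
      forall A : set R, measurable A -> mu (`[0, 1]%classic `&` T @^-1` A) = mu A].

Definition the_acip T (mu : probability (measurableTypeR R) R) : Prop :=
  acip T mu /\
  forall nu : probability (measurableTypeR R) R, acip T nu ->
    forall A : set R, measurable A -> nu A = mu A.

Definition entropy_term (p : R) : R := - p * ln p.

Definition partition_entropy f (mu : probability (measurableTypeR R) R)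
    (n : nat) : \bar R :=
  (\esum_(w in [set: n.-tuple nat])
     (entropy_term (fine (mu (coding f @` cylinder w))))%:E)%E.

Definition entropy f (mu : probability (measurableTypeR R) R) : \bar R :=
  limn (fun n => ((n%:R^-1)%:E * partition_entropy f mu n)%E).

End markov_map.

(* Main.v *)
(* All the maps are increasing with affine branches: they send each interval of
   a partition of ]0, 1] affinely onto ]0, 1].  The potential of such a map
   depends only on the first symbol, so all its variations vanish, and Lebesgue
   measure is invariant with entropy the sum of - p ln p over the lengths p of
   the intervals.  For T the lengths are 2^-1, 2^-2, ...; T_k keeps the first k
   of them and splits the remaining interval of length 2^-k into so many small
   ones that the entropy is at least a constant times k.
   Lebesgue measure is the only absolutely continuous invariant probability
   because it is mixing: an interval ]0, x[ meets the n-th preimage of A in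
   measure x |A| up to an error that is contracted by each branch, and the
   convergence of |T^-n A inter E| to |A| |E| passes to all Borel sets E by the
   pi-lambda theorem.  If nu is invariant with density f, comparing f with simple
   functions below it gives nu A = nu (T^-n A) >= |A| in the limit, and taking
   complements gives equality. *)

Require Import Defs.
From HB Require Import structures.
From mathcomp Require Import finmap.
From mathcomp Require Import all_boot all_order all_algebra.
From mathcomp Require Import all_classical all_reals all_analysis.
From mathcomp Require Import measurable_realfun.
From mathcomp Require Import ring lra.
Import Order.TTheory GRing.Theory Num.Theory.
Import numFieldNormedType.Exports.

(** * Sums of nonnegative extended reals over pairs and over words *)

Lemma exchange_esumT (R : realType) (I J : choiceType) (F : I -> J -> \bar R) :
  (forall i j, 0 <= F i j)%E ->
  (\esum_(i in [set: I]) \esum_(j in [set: J]) F i j =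
   \esum_(j in [set: J]) \esum_(i in [set: I]) F i j)%E.
Proof.
move=> F0; rewrite !esum_esum//.
rewrite (reindex_esum ([set: J] `*`` (fun=> [set: I]%classic)) _
  (fun k : J * I => (k.2, k.1)))//.
split => //; first by move=> [i1 i2] [j1 j2] /= _ _ [] -> ->.
by move=> [i j] _; exists (j, i).
Qed.

(** Splitting off the first letter drives the inductions on word length in the entropy
    computation. *)
Lemma esum_tupleS (R : realType) n (F : n.+1.-tuple nat -> \bar R) :
  (forall w, 0 <= F w)%E ->
  (\esum_(w in [set: n.+1.-tuple nat]) F w =
   \sum_(i <oo) \esum_(w in [set: n.-tuple nat]) F [tuple of i :: w])%E.
Proof.
move=> F0; rewrite nneseries_esumT; last by move=> i; exact: esum_ge0.
rewrite esum_esum//.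
rewrite (reindex_esum ([set: nat] `*`` (fun=> [set: n.-tuple nat]%classic)) _
  (fun k : nat * n.-tuple nat => [tuple of k.1 :: k.2]))//.
split => //.
- move=> [i w] [j v] _ _ /= /(congr1 val) /= [-> e].
  by congr (_, _); exact: val_inj.
- by move=> w _; case/tupleP: w => i w; exists (i, w).
Qed.

Lemma nneseries_le (R : realType) (u : nat -> R) (c : R) :
  (forall i, 0 <= u i) ->
  (forall n, \sum_(0 <= i < n) u i <= c) -> (\sum_(i <oo) (u i)%:E <= c%:E)%E.
Proof.
move=> u0 uc; apply: lime_le.
  by apply: is_cvg_nneseries => i _ _; rewrite lee_fin.
by apply: nearW => n; rewrite sumEFin lee_fin.
Qed.

Lemma entropy_term_ge0 (R : realType) (p : R) :
  0 < p <= 1 -> 0 <= entropy_term p.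
Proof.
move=> /andP[p0 p1]; rewrite /entropy_term mulNr -mulrN.
by rewrite mulr_ge0 ?(ltW p0)// oppr_ge0 ln_le0.
Qed.

(** * Probabilities read as real numbers *)

Section probability_fine.
Set Implicit Arguments.
Unset Strict Implicit.
Context {d} {T : measurableType d} {R : realType} (mu : probability T R).
Implicit Types A B : set T.

Lemma probability_fineK A : measurable A -> (fine (mu A))%:E = mu A.
Proof. by move=> mA; rewrite fineK// fin_num_measure. Qed.

Lemma fine_probability01 A : measurable A -> 0 <= fine (mu A) <= 1.
Proof.
move=> mA; rewrite -!lee_fin fineK ?fin_num_measure//.
by rewrite measure_ge0 probability_le1.
Qed.

Lemma fine_probabilityD A B : measurable A -> measurable B -> A `<=` B ->
  fine (mu (B `\` A)) = fine (mu B) - fine (mu A).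
Proof.
move=> mA mB AB; rewrite -fineB ?fin_num_measure// measureD//.
  by rewrite setIidr.
by rewrite (le_lt_trans (probability_le1 _ _))// ltry.
Qed.

Lemma fine_probabilityS A B : measurable A -> measurable B -> A `<=` B ->
  fine (mu A) <= fine (mu B).
Proof.
move=> mA mB AB; apply: fine_le; rewrite ?fin_num_measure//.
by apply: le_measure; rewrite ?inE.
Qed.

Lemma fine_probabilityU A B : measurable A -> measurable B ->
  A `&` B = set0 -> fine (mu (A `|` B)) = fine (mu A) + fine (mu B).
Proof.
by move=> mA mB AB; rewrite -fineD ?fin_num_measure// measureU.
Qed.

End probability_fine.

(** * Increasing maps with affine branches *)

Section affine_markov_map.
Set Implicit Arguments.
Unset Strict Implicit.
Context {R : realType} (a : nat -> R).

Definition len i : R := a i - a i.+1.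
Definition branch i (x : R) : R := a i.+1 + len i * x.
Definition branch_inv i (y : R) : R := (y - a i.+1) / len i.

(** The intervals are closed on the left because each branch is inverted on the image of [0, 1[.
    Once [a] decreases from 1 to 0, [xget] falls back on its default only outside [0, 1]. *)
Definition branch_map (x : R) : R :=
  if (x == 0) || (x == 1) then x
  else branch_inv (xget 0%N [set i | a i.+1 <= x < a i]) x.

Hypothesis a_0 : a 0%N = 1.
Hypothesis a_decr : forall i, a i.+1 < a i.
Hypothesis a_cvg0 : a i @[i --> \oo] --> (0 : R).

Lemma a_decreasing : decreasing_seq a.
Proof. by apply/decreasing_seqP. Qed.

Lemma a_ltE i j : (a i < a j) = (j < i)%N.
Proof.
have h := a_decreasing i j.
by rewrite ltNge ltnNge -a_decreasing.
Qed.

Lemma a_gt0 i : 0 < a i.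
Proof.
have h : nonincreasing_seq a by apply/nonincreasing_seqP => n; exact/ltW.
apply: le_lt_trans (a_decr i).
rewrite -(cvg_lim _ a_cvg0)//.
apply: nonincreasing_cvgn_ge => //; apply/cvg_ex; by exists 0.
Qed.

Lemma a_le1 i : a i <= 1.
Proof. by rewrite -a_0 a_decreasing. Qed.

Lemma len_gt0 i : 0 < len i.
Proof. by rewrite subr_gt0. Qed.

(** A common bound rather than the maximum: the first interval has length [1 - a 1], all others lie
    below [a 1]. It serves as the contraction rate throughout. *)
Definition max_len : R := Num.max (1 - a 1%N) (a 1%N).

Lemma max_len_lt1 : max_len < 1.
Proof.
rewrite gt_max; have := a_decr 0%N; have := a_gt0 1%N; rewrite a_0; lra.
Qed.

Lemma len_le i : len i <= max_len.
Proof.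
rewrite /len /max_len le_max; case: i => [|i]; first by rewrite a_0 lexx.
have h : a i.+1 <= a 1%N by rewrite a_decreasing.
by apply/orP; right; have := a_gt0 i.+2; lra.
Qed.

Lemma max_len_gt0 : 0 < max_len.
Proof. exact: lt_le_trans (len_gt0 0%N) (len_le _). Qed.

Lemma branchK i : cancel (branch i) (branch_inv i).
Proof.
by move=> x; have := len_gt0 i; rewrite /branch_inv /branch => h; field; lra.
Qed.

Lemma branch_invK i : cancel (branch_inv i) (branch i).
Proof.
by move=> x; have := len_gt0 i; rewrite /branch_inv /branch => h; field; lra.
Qed.

Lemma branch_le i : {mono branch i : x y / x <= y}.
Proof. by move=> x y; rewrite /branch lerD2l ler_pM2l// len_gt0. Qed.

Lemma branch_lt i : {mono branch i : x y / x < y}.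
Proof. exact/leW_mono/branch_le. Qed.

Lemma branch0 i : branch i 0 = a i.+1.
Proof. by rewrite /branch mulr0 addr0. Qed.

Lemma branch1 i : branch i 1 = a i.
Proof. by rewrite /branch /len; ring. Qed.

Lemma ex_digit_oc (x : R) : 0 < x <= 1 -> exists i, a i.+1 < x <= a i.
Proof.
move=> /andP[x0 x1].
have ex : exists i, a i.+1 < x.
  have [N _ hN] : \forall i \near \oo, a i < x by exact: cvgr_lt a_cvg0 _ x0.
  by exists N; apply: hN => /=.
case: (ex_minnP ex) => -[|m] hm mn; first by exists 0%N; rewrite hm a_0.
by exists m.+1; rewrite hm leNgt/=; apply/negP => /mn; rewrite ltnn.
Qed.

Lemma ex_digit_co (x : R) : 0 < x < 1 -> exists i, a i.+1 <= x < a i.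
Proof.
move=> /andP[x0 x1]; have [|i] := @ex_digit_oc x; first by rewrite x0 ltW.
move=> /andP[h]; rewrite le_eqVlt => /orP[/eqP e|h']; last first.
  by exists i; rewrite ltW.
case: i h e => [|i] h e; first by move: x1; rewrite e a_0 ltxx.
by exists i; rewrite e lexx a_decr.
Qed.

Lemma digit_co_inj (x : R) i j : a i.+1 <= x < a i -> a j.+1 <= x < a j ->
  i = j.
Proof.
move=> /andP[h1 h2] /andP[h3 h4]; apply/eqP; rewrite eqn_leq.
have := le_lt_trans h1 h4; rewrite a_ltE ltnS => ->.
by have := le_lt_trans h3 h2; rewrite a_ltE ltnS => ->.
Qed.

Lemma branch_map_digit (x : R) i : 0 < x < 1 -> a i.+1 <= x < a i ->
  branch_map x = branch_inv i x.
Proof.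
move=> /andP[x0 x1] h; rewrite /branch_map gt_eqF// lt_eqF//=.
congr branch_inv; apply: (@digit_co_inj x) => //.
exact: (@xgetPex _ 0%N [set i | a i.+1 <= x < a i] (ex_intro _ i h)).
Qed.

Lemma branch_mapK i y : 0 <= y < 1 -> branch_map (branch i y) = y.
Proof.
move=> /andP[y0 y1].
have h : a i.+1 <= branch i y < a i.
  by rewrite -branch0 -branch1 branch_le branch_lt y0.
rewrite (@branch_map_digit _ i) ?branchK//.
by case/andP: h => h1 h2; rewrite (lt_le_trans (a_gt0 _) h1)
  (lt_le_trans h2 (a_le1 _)).
Qed.

Lemma branch_itv i x : x \in `[0, 1] -> branch i x \in `[0, 1].
Proof.
rewrite !in_itv/= => /andP[x0 x1]; apply/andP; split.
  by rewrite (le_trans (ltW (a_gt0 i.+1)))// -branch0 branch_le.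
by rewrite (le_trans _ (a_le1 i))// -branch1 branch_le.
Qed.

(** Punctured neighbourhoods within [0, 1] are nonempty even at the endpoints, so the limit defining
    [deriv01] is unique. *)
Lemma proper_within01 (x : R) : x \in `[0, 1] ->
  ProperFilter (within `[0, 1]%classic (x^')).
Proof.
rewrite in_itv/= => /andP[x0 x1].
apply: Build_ProperFilter_ex => A /nbhs_ballP[e /= e0 xeA].
suff [y [yx y01 xye]] : exists y : R, [/\ y != x, y \in `[0, 1] & `|x - y| < e].
  by exists y; exact: xeA.
have [m [m0 me m2]] : exists m : R, [/\ 0 < m, m < e & m <= 1 / 2].
  exists (Num.min (e / 2) (1 / 2)); rewrite lt_min gt_min ge_min lexx orbT.
  by rewrite !divr_gt0//; split=> //; apply/orP; left; lra.
(* A step of length at most 1/2, taken away from the nearer endpoint, stays in [0, 1]. *)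
have [xl|xg] := leP x (1 / 2); [exists (x + m)|exists (x - m)]; split.
- by rewrite gt_eqF//; lra.
- by rewrite in_itv/=; lra.
- by rewrite ltr_norml; lra.
- by rewrite lt_eqF//; lra.
- by rewrite in_itv/=; lra.
- by rewrite ltr_norml; lra.
Qed.

Lemma diff_quot_branch i (x : R) : x \in `[0, 1] ->
  diff_quot (branch i) x y @[y --> within `[0, 1]%classic (x^')] --> len i.
Proof.
move=> x01; apply: cvg_near_cst.
rewrite near_withinE near_withinE; near=> y => /= yx y01.
by rewrite /diff_quot /branch; field; rewrite subr_eq0.
Unshelve. all: by end_near. Qed.

Lemma deriv01_branch i (x : R) : x \in `[0, 1] ->
  deriv01 (branch i) x = len i.
Proof.
move=> x01; have := proper_within01 x01 => ?.
exact: cvg_lim (diff_quot_branch x01).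
Qed.

Lemma C1_branch i : C1_01 (branch i).
Proof.
split=> [x x01|].
  by apply/cvg_ex; exists (len i); exact: diff_quot_branch.
apply: (@subspace_eq_continuous _ _ _ (cst (len i))); last first.
  by apply: continuous_subspaceT => x; exact: cst_continuous.
by move=> x; rewrite inE => x01; rewrite /from_subspace/= deriv01_branch.
Qed.

Lemma branch_contracting : uniformly_contracting branch.
Proof.
(* One step already contracts: the derivative of a branch is its constant slope. *)
exists 1%N, max_len; split => //; first exact: max_len_lt1.
move=> w x _.
have -> : branch_comp branch w = fun x => a (thead w).+1 + len (thead w) * x.
  by apply/funext => y; case/tupleP: w => i w; rewrite tuple0 theadE.
rewrite derive1E deriveD// derive_cst add0r deriveM// derive_cst derive_id.
rewrite scaler0 addr0.
by rewrite /GRing.scale/= mulr1 ger0_norm ?len_le// ltW// len_gt0.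
Qed.

Lemma markov_branch : countable_markov_map Increasing branch branch_map.
Proof.
split.
- exact: branch_itv.
- exact: C1_branch.
- split.
  + by move=> i x y _ _; rewrite branch_lt.
  + by rewrite branch1.
  + by move=> i; rewrite branch1 branch0.
  + by move=> m n; rewrite !branch1 a_decreasing.
  + by under eq_fun do rewrite branch1.
- exact: branch_contracting.
- by move=> i y; rewrite in_itv/=; exact: branch_mapK.
- by rewrite /branch_map eqxx.
- by rewrite /branch_map eqxx orbT.
Qed.

(* Unlike branch_map, which acts on the intervals [a i.+1, a i[, the coding
   of sequences is a bijection onto ]0, 1], so that the expansion of a point
   must use the intervals ]a i.+1, a i]. *)
Definition digit (x : R) : nat := xget 0%N [set i | a i.+1 < x <= a i].
Definition expand (x : R) : R := branch_inv (digit x) x.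
Definition itinerary (x : R) : nat -> nat := fun n => digit (iter n expand x).

(** * Affine compositions along words and the coding map *)

Lemma branch_comp_affine w : exists2 l, 0 < l <= max_len ^+ size w &
  forall x, branch_comp branch w x = branch_comp branch w 0 + l * x.
Proof.
elim: w => [|i w [l /andP[l0 lw] E]] /=; first by exists 1 => [|x];
  [rewrite ltr01 lexx|ring].
exists (len i * l) => [|x]; last by rewrite E /branch; ring.
by rewrite mulr_gt0 ?len_gt0//= exprS ler_pM ?len_le// ltW// len_gt0.
Qed.

Lemma branch_comp_range w (x : R) : 0 <= x <= 1 ->
  0 <= branch_comp branch w x <= 1.
Proof.
move=> h; elim: w => //= i w h'.
by have := @branch_itv i (branch_comp branch w x); rewrite !in_itv; exact.
Qed.

Lemma branch_comp_cat u v :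
  branch_comp branch (u ++ v) = branch_comp branch u \o branch_comp branch v.
Proof. by elim: u => //= i u ->. Qed.

Lemma branch_comp0_range w : 0 <= branch_comp branch w 0 <= 1.
Proof. by apply: branch_comp_range; rewrite lexx ler01. Qed.

(** Appending a letter [i] replaces the base point 0 by the positive point [branch i 0], so the
    truncations increase; they are bounded by 1. *)
Lemma is_cvg_coding s : cvgn (fun n => branch_comp branch (mkseq s n) 0).
Proof.
apply: nondecreasing_is_cvgn; last first.
  exists 1 => _ [n _ <-].
  by have /andP[] := branch_comp0_range (mkseq s n).
apply/nondecreasing_seqP => n; rewrite mkseqS -cats1 branch_comp_cat /=.
have [l /andP[l0 _] E] := branch_comp_affine (mkseq s n).
by rewrite [leRHS]E lerDl mulr_ge0 ?(ltW l0)// branch0 ltW// a_gt0.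
Qed.

Lemma coding_range s : 0 <= coding branch s <= 1.
Proof.
apply/andP; split.
  apply: limr_ge; first exact: is_cvg_coding.
  by apply: nearW => n; have /andP[] := branch_comp0_range (mkseq s n).
apply: limr_le; first exact: is_cvg_coding.
by apply: nearW => n; have /andP[] := branch_comp0_range (mkseq s n).
Qed.

Lemma codingE s :
  coding branch s = branch (s 0%N) (coding branch (left_shift s)).
Proof.
apply/cvg_lim => //; rewrite -(cvg_shiftS _) /=.
rewrite (_ : (fun n => _) = fun n =>
  branch (s 0%N) (branch_comp branch (mkseq (left_shift s) n) 0)).
  apply: cvgD; first exact: cvg_cst.
  by apply: cvgMr; exact: is_cvg_coding.
by apply/funext => n; rewrite /mkseq /= (iotaDl 1 0) -map_comp.
Qed.

(** By [codingE] a code with first letter [i] is at least [branch i 0], so 0 is never coded. *)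
Lemma coding_oc s : 0 < coding branch s <= 1.
Proof.
have /andP[_ ->] := coding_range s; rewrite codingE andbT.
apply: lt_le_trans (a_gt0 (s 0%N).+1) _; rewrite -branch0 branch_le.
by have /andP[] := coding_range (left_shift s).
Qed.

Lemma expand_oc (x : R) : 0 < x <= 1 ->
  0 < expand x <= 1 /\ branch (digit x) (expand x) = x.
Proof.
move=> x01; rewrite /expand branch_invK; split => //.
rewrite /digit.
have := @xgetPex _ 0%N [set i | a i.+1 < x <= a i] (ex_digit_oc x01).
set i := xget _ _ => /= h; rewrite -(branch_lt i) -(branch_le i) branch_invK.
by rewrite branch0 branch1.
Qed.

Lemma iter_expand_oc (x : R) n : 0 < x <= 1 -> 0 < iter n expand x <= 1.
Proof. by move=> x01; elim: n => //= n /expand_oc[]. Qed.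

Lemma branch_comp_itinerary (x : R) n : 0 < x <= 1 ->
  branch_comp branch (mkseq (itinerary x) n) (iter n expand x) = x.
Proof.
move=> x01; elim: n => // n IH; rewrite mkseqS -cats1 branch_comp_cat /=.
by have [_ ->] := expand_oc (iter_expand_oc n x01).
Qed.

(** The point and its n-th truncation are the images of [iter n expand x] and of 0 under one affine
    map, hence at most [max_len ^+ n] apart. *)
Lemma coding_itinerary (x : R) : 0 < x <= 1 -> coding branch (itinerary x) = x.
Proof.
move=> x01; apply/cvg_lim => //; apply/cvgrPdist_lt => e e0.
have := cvgr_lt _ (@cvg_expr _ max_len _) _ e0.
move=> /(_ _); case => [|N _ hN];
  first by rewrite ger0_norm ?max_len_lt1// ltW// max_len_gt0.
exists N => // n Nn /=.
have [l /andP[l0 lw] E] := branch_comp_affine (mkseq (itinerary x) n).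
rewrite -[in X in `|X - _|](branch_comp_itinerary n x01) E addrC addKr.
have /andP[y0 y1] := iter_expand_oc n x01.
rewrite ger0_norm ?mulr_ge0 ?ltW//.
apply: le_lt_trans (hN n Nn); rewrite size_mkseq in lw.
by rewrite -[leRHS]mulr1 ler_pM// ltW.
Qed.

Fixpoint word_len (w : seq nat) : R :=
  if w is i :: w' then len i * word_len w' else 1.

(** The coding is onto ]0, 1], and increasing affine maps preserve this half-open form; the
    induction peels off the first letter. *)
Lemma coding_cylinder n (w : n.-tuple nat) :
  coding branch @` cylinder w =
  `]branch_comp branch w 0, branch_comp branch w 1]%classic.
Proof.
elim: n w => [|n IH] w.
  rewrite tuple0/=; apply/seteqP; split => x /=; rewrite in_itv/=.
    by move=> [s _ <-]; exact: coding_oc.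
  by move=> x01; exists (itinerary x); [case|exact: coding_itinerary].
case/tupleP: w => i w.
transitivity (branch i @` (coding branch @` cylinder w)).
  apply/seteqP; split => [_ [s hs <-]|_ [_ [s hs <-] <-]].
    have s0 : s 0%N = i by have := hs ord0; rewrite tnth0.
    exists (coding branch (left_shift s)); last by rewrite [RHS]codingE s0.
    exists (left_shift s) => // j; have := hs (lift ord0 j).
    by rewrite tnthS.
  pose s' n := if n is m.+1 then s m else i.
  exists s'; last by rewrite codingE.
  move=> j; case: (unliftP ord0 j) => [k|] ->; last by rewrite tnth0.
  by rewrite tnthS /= hs.
rewrite IH; apply/seteqP; split => [_ [x /= + <-]|x /=].
  by rewrite !in_itv/= branch_lt branch_le.
rewrite !in_itv/= => h; exists (branch_inv i x); last by rewrite branch_invK.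
by rewrite /= in_itv/= -(branch_lt i) -(branch_le i) branch_invK.
Qed.

Lemma branch_comp_len w :
  branch_comp branch w 1 - branch_comp branch w 0 = word_len w.
Proof.
elim: w => [|i w /= <-] /=; first by rewrite subr0.
by rewrite /branch; ring.
Qed.

Lemma word_len_gt0 w : 0 < word_len w.
Proof. by elim: w => //= i w; apply: mulr_gt0; exact: len_gt0. Qed.

(** * Potential, variations and branch lengths *)

Lemma potential_branch s : potential branch s = ln (len (s 0%N)).
Proof.
rewrite /potential deriv01_branch; last by rewrite in_itv/= coding_range.
by rewrite gtr0_norm// len_gt0.
Qed.

Lemma potential_finite_branch : potential_finite branch.
Proof.
move=> s; rewrite deriv01_branch; last by rewrite in_itv/= coding_range.
by rewrite gt_eqF// len_gt0.
Qed.

Lemma var_n_branch n : (0 < n)%N -> var_n (potential branch) n = 0%E.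
Proof.
move=> n0; rewrite /var_n (_ : [set _ | _ in _]%classic = [set 0%E]%classic)
  ?ereal_sup1//.
case: n n0 => // n _.
suff h (w : n.+1.-tuple nat) :
    ereal_sup [set (`|potential branch p.1 - potential branch p.2|)%:E
              | p in cylinder w `*` cylinder w] = 0%E.
  apply/seteqP; split => [_ [w _ <-]|_ ->]; first by rewrite h.
  (* A word has to be exhibited: the supremum over an empty family would be [-oo]. The sequence [s]
     below does the same for the cylinder. *)
  by exists [tuple of nseq n.+1 0%N].
rewrite (_ : [set _ | _ in _]%classic = [set 0%E]%classic) ?ereal_sup1//.
have E s : cylinder w s -> s 0%N = tnth w ord0 by move=> /(_ ord0).
apply/seteqP; split => [_ [[s t] /= [hs ht] <-]|_ ->] /=.
  by rewrite !potential_branch (E s hs) (E t ht) subrr normr0.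
pose s m := nth 0%N w m.
have hs : cylinder w s by move=> j; rewrite /s -tnth_nth.
by exists (s, s) => //=; rewrite subrr normr0.
Qed.

Lemma sum_of_variations_branch : sum_of_variations (potential branch) = 0%E.
Proof.
apply: eseries0 => n n1 _; exact: var_n_branch.
Qed.

Lemma branch_length_branch i : branch_length branch i = (len i)%:E.
Proof.
rewrite /branch_length (_ : _ @` _ = `[a i.+1, a i]%classic).
  by rewrite lebesgue_measure_itv/= lte_fin a_decr -EFinB.
apply/seteqP; split => [_ [x /= + <-]|x /=].
  by rewrite !in_itv/= -branch0 -branch1 !branch_le.
rewrite !in_itv/= => h; exists (branch_inv i x); last by rewrite branch_invK.
by rewrite /= in_itv/= -(branch_le i) -(branch_le i _ 1) branch_invK branch0
  branch1.
Qed.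

(** * Lebesgue measure is the only absolutely continuous invariant probability *)

Local Notation borel A := (measurable (A : set (measurableTypeR R))).
Local Notation oo01 := `]0, 1[%classic.
Local Notation leb := (@lebesgue_measure R).
Definition unif : probability (measurableTypeR R) R := uniform_prob (@ltr01 R).
Arguments unif : simpl never.

(** The endpoints carry no mass. The open interval is preferred because the preimages of its subsets
    under distinct [branch_inv i] are disjoint. *)
Lemma unifE (A : set (measurableTypeR R)) : measurable A ->
  unif A = leb (A `&` oo01).
Proof.
move=> mA; rewrite /unif/= /uniform_prob integral_uniform_pdf.
rewrite (eq_integral (cst 1%E)); last first.
  move=> x; rewrite inE/= in_itv/= => -[_ x01].
  by rewrite /uniform_pdf x01 subr0 invr1.
rewrite integral_cst ?mul1e; last exact: measurableI.
apply/eqP; rewrite eq_le; apply/andP; split; last first.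
  apply: le_measure; rewrite ?inE; [exact: measurableI..|].
  by apply: setIS; apply: subset_itvW.
have m2 : measurable [set 0; 1 : measurableTypeR R]%classic.
  by apply: measurableU; exact: measurable_set1.
apply: (@le_trans _ _ (leb ((A `&` oo01) `|` [set 0; 1]%classic))).
  apply: le_measure; rewrite ?inE;
    [exact: measurableI|by apply: measurableU => //; exact: measurableI|].
  move=> x [Ax] /=; rewrite !in_itv/= => /andP[].
  rewrite le_eqVlt => /orP[/eqP <-|x0]; first by right; left.
  rewrite le_eqVlt => /orP[/eqP ->|x1]; first by right; right.
  by left; rewrite x0 x1.
apply: (le_trans (measureU2 _ _ _)) => //; first exact: measurableI.
rewrite -[leRHS]adde0 leeD2l// (le_trans (measureU2 _ _ _))//.
rewrite [X in (X + _)%E]lebesgue_measure_set1.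
by rewrite [X in (_ + X)%E]lebesgue_measure_set1 adde0.
Qed.

Lemma unif_sub (A : set (measurableTypeR R)) : measurable A ->
  A `<=` oo01 -> unif A = leb A.
Proof. by move=> mA A01; rewrite unifE// setIidl. Qed.

(** * Lebesgue measure of preimages under the inverse branches *)

Lemma measurable_branch_inv i :
  measurable_fun [set: measurableTypeR R]
    (branch_inv i : _ -> measurableTypeR R).
Proof.
apply: continuous_measurable_fun => x.
by apply: cvgMr_tmp; apply: cvgB; [exact: cvg_id|exact: cvg_cst].
Qed.

Lemma measurable_preimage_branch_inv i (A : set (measurableTypeR R)) :
  measurable A -> measurable (branch_inv i @^-1` A).
Proof.
by move=> mA; rewrite -[X in measurable X]setTI; exact: measurable_branch_inv.
Qed.

(** Lebesgue measure is determined by its values on half-open intervals, where the rescaled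
    pushforward is computed directly. *)
Lemma leb_branch i (A : set (measurableTypeR R)) : measurable A ->
  leb (branch_inv i @^-1` A) = ((len i)%:E * leb A)%E.
Proof.
move=> mA.
have l0 : 0 <= ((len i)^-1)%R by rewrite invr_ge0 ltW// len_gt0.
have mg := @measurable_branch_inv i.
have /(_ mg) -> : leb A = mscale (NngNum l0)
    (pushforward leb (branch_inv i : _ -> measurableTypeR R)) A.
  move=> m; apply: lebesgue_measure_unique => // _ [[x y] _ <-] /=.
  rewrite /mscale/= /pushforward.
  rewrite (_ : _ @^-1` _ = `]branch i x, branch i y]%classic).
    rewrite !lebesgue_measure_itv/= !lte_fin branch_lt; case: ifPn => // _.
      by rewrite -!EFinB -EFinM; congr EFin; rewrite /branch;
        have := len_gt0 i => h; field; lra.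
    by rewrite mule0.
  by apply/seteqP; split => z /=;
    rewrite !in_itv/= -(branch_lt i x) -(branch_le i _ y) branch_invK.
rewrite /mscale/= /pushforward muleA -EFinM mulfV ?mul1e//.
by rewrite gt_eqF// len_gt0.
Qed.

(** For subsets of ]0, 1[ this is the preimage under [branch_map], written without case distinctions
    on digits and endpoints. *)
Definition pull (A : set R) : set R := \bigcup_i (branch_inv i @^-1` A).

Lemma measurable_pull (A : set (measurableTypeR R)) :
  measurable A -> borel (pull A).
Proof.
by move=> mA; apply: bigcup_measurable => i _;
  exact: measurable_preimage_branch_inv.
Qed.

Lemma branch_inv_oo (A : set R) i x : A `<=` oo01 -> A (branch_inv i x) ->
  a i.+1 < x < a i.
Proof.
move=> A01 /A01 /=; rewrite in_itv/=.
by rewrite -(branch_lt i 0) -(branch_lt i _ 1) branch_invK branch0 branch1.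
Qed.

Lemma pull_sub A : A `<=` oo01 -> pull A `<=` oo01.
Proof.
move=> A01 x [i _ /= /(branch_inv_oo A01) /andP[h1 h2]].
by rewrite in_itv/= (lt_trans (a_gt0 _) h1) (lt_le_trans h2)// a_le1.
Qed.

Lemma trivIset_pull A : A `<=` oo01 ->
  trivIset setT (fun i => branch_inv i @^-1` A).
Proof.
move=> A01 i j _ _ [x [/= /(branch_inv_oo A01) /andP[h1 h2]
  /(branch_inv_oo A01) /andP[h3 h4]]].
by apply: (@digit_co_inj x); rewrite ltW.
Qed.

Lemma unif_branch i A : borel A -> A `<=` oo01 ->
  unif (branch_inv i @^-1` A) = ((len i)%:E * unif A)%E.
Proof.
move=> mA A01; rewrite unif_sub ?leb_branch ?unif_sub//.
  exact: measurable_preimage_branch_inv.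
by apply: subset_trans (pull_sub A01); exact: (@bigcup_sup _ _ i).
Qed.

Lemma series_len j : (\sum_(i <oo) (len (j + i))%:E = (a j)%:E)%E.
Proof.
apply/cvg_lim => //.
apply: cvg_trans (_ : (a j - a (j + n))%:E @[n --> \oo] --> _).
  apply: near_eq_cvg; apply: nearW => n.
  rewrite sumEFin /=; congr (_%:E); elim: n => [|n IH].
    by rewrite big_geq// addn0 subrr.
  by rewrite big_nat_recr//= -IH /len addnS; ring.
apply: cvg_EFin; first by apply: nearW.
rewrite -[in X in _ --> X](subr0 (a j)); apply: cvgB; first exact: cvg_cst.
exact: (cvg_comp _ _ (cvg_addnl j) a_cvg0).
Qed.

(** Below the breakpoint [a j] lie exactly the pieces of index at least [j], whose scaling factors
    sum to [a j] by telescoping. *)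
Lemma unif_pull_lt j A : borel A -> A `<=` oo01 ->
  unif (pull A `&` `]-oo, a j[%classic) = ((a j)%:E * unif A)%E.
Proof.
move=> mA A01.
have -> : pull A `&` `]-oo, a j[%classic =
    (\bigcup_i (branch_inv (j + i)%N @^-1` A))%classic.
  apply/seteqP; split => [x [[i _ Ax]] /=|x [i _ Ax]].
    rewrite in_itv/= => xj; exists (i - j)%N => //=.
    rewrite subnKC//; have /andP[h _] := branch_inv_oo A01 Ax.
    by have := lt_trans h xj; rewrite a_ltE ltnS.
  split; first by exists (j + i)%N.
  rewrite /= in_itv/=; have /andP[_ h] := branch_inv_oo A01 Ax.
  by rewrite (lt_le_trans h)// a_decreasing leq_addr.
rewrite measure_bigcup//=; last 2 first.
- by move=> i _; exact: measurable_preimage_branch_inv.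
- move=> i k _ _ h; apply: (@addnI j); exact: (trivIset_pull A01) h.
under eq_eseriesr do rewrite unif_branch//.
have uA : unif A = (fine (unif A))%:E by rewrite fineK// fin_num_measure.
rewrite uA; under eq_eseriesr do rewrite muleC.
rewrite nneseriesZl => [|i _]; last by rewrite lee_fin ltW// len_gt0.
rewrite [unif A in RHS]uA muleC -series_len; congr (_ * _)%E.
by apply: eq_eseriesl => i; rewrite in_setT.
Qed.

Lemma unif_pull A : borel A -> A `<=` oo01 -> unif (pull A) = unif A.
Proof.
move=> mA A01; rewrite -[RHS]mul1e -a_0 -unif_pull_lt// setIidl// a_0.
by apply: subset_trans (pull_sub A01) _ => x /=; rewrite !in_itv/= => /andP[].
Qed.

Lemma unif_lt x : 0 <= x <= 1 -> unif `]-oo, x[%classic = x%:E.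
Proof.
move=> /andP[x0 x1]; rewrite unifE// (_ : _ `&` _ = `]0, x[%classic).
  rewrite lebesgue_measure_itv/= lte_fin; case: ltP => [_|x0'];
    first by rewrite -EFinB subr0.
  by congr EFin; apply/eqP; rewrite eq_le x0 x0'.
apply/seteqP; split => y /=; rewrite !in_itv/=.
  by move=> [-> /andP[-> _]].
by move=> /andP[-> yx]; rewrite yx (lt_le_trans yx).
Qed.

Local Notation P A := (fine (unif A)).

(** Below [x] lie the whole pieces of index above [j], and the part of piece [j] cut off at [x], a
    copy of [A] cut at [branch_inv j x] and scaled by [len j]. *)
Lemma pull_lt_decomp A j x : borel A -> A `<=` oo01 -> a j.+1 <= x < a j ->
  P (pull A `&` `]-oo, x[%classic) =
  a j.+1 * P A + len j * P (A `&` `]-oo, branch_inv j x[%classic).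
Proof.
move=> mA A01 /andP[xj jx].
have mB : borel (A `&` `]-oo, branch_inv j x[%classic) by apply: measurableI.
have mpA := measurable_pull mA.
have B01 : A `&` `]-oo, branch_inv j x[%classic `<=` oo01 by move=> y [/A01].
have -> : pull A `&` `]-oo, x[%classic = (pull A `&` `]-oo, a j.+1[%classic) `|`
    (branch_inv j @^-1` (A `&` `]-oo, branch_inv j x[%classic)).
  apply/seteqP; split => [y [] [i _ Ay] /=|y []].
  - rewrite in_itv/= => yx; have /andP[iy yi] := branch_inv_oo A01 Ay.
    have [yj|jy] := ltP y (a j.+1); first by left; split;
      [exists i|rewrite in_itv].
    right; have ij : i = j.
      apply: (@digit_co_inj y); first by rewrite ltW.
      by rewrite jy (lt_trans yx).
    by rewrite -ij in_itv/=; split => //; rewrite -(branch_lt i) !branch_invK.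
  - move=> [pAy /=]; rewrite !in_itv/= => yj; split => //=.
    exact: lt_le_trans yj _.
  - move=> /= [Ay]; rewrite !in_itv/= => yx; split; first by exists j.
    by rewrite -(branch_invK j x) -(branch_invK j y) branch_lt.
rewrite fine_probabilityU.
- rewrite unif_pull_lt// unif_branch// !fineM ?fin_num_measure//.
- exact: measurableI.
- exact: measurable_preimage_branch_inv.
apply/seteqP; split => // y [[_ /=]]; rewrite in_itv/= => yj.
by move=> /(branch_inv_oo B01) /andP[/(lt_trans yj)]; rewrite ltxx.
Qed.

Lemma iter_pull A n : borel A -> A `<=` oo01 ->
  [/\ borel (iter n pull A),
    iter n pull A `<=` oo01 & unif (iter n pull A) = unif A].
Proof.
move=> mA A01; elim: n => //= n [mI I01 uI]; split.
- exact: measurable_pull.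
- exact: pull_sub.
- by rewrite unif_pull.
Qed.

(* By pull_lt_decomp the discrepancy at x after n + 1 steps is len j times the
   discrepancy at branch_inv j x after n steps. *)
Lemma mixing_lt A n x : borel A -> A `<=` oo01 -> 0 <= x <= 1 ->
  `|P (iter n pull A `&` `]-oo, x[%classic) - P A * x| <= max_len ^+ n.
Proof.
move=> mA A01; elim: n x => [|n IH] x x01.
  have mAx : borel (A `&` `]-oo, x[%classic) by exact: measurableI.
  have /andP[h3 h4] := fine_probability01 unif mA.
  have /andP[h1 h2] := fine_probability01 unif mAx.
  have : 0 <= P A * x <= 1.
    by case/andP: x01 => ? ?; rewrite mulr_ge0//= mulr_ile1.
  by rewrite expr0 ler_norml; lra.
have [mI I01 uI] := iter_pull n mA A01.
have [->|x0] := eqVneq x 0.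
  rewrite mulr0 subr0 (_ : _ `&` _ = set0) ?measure0 ?normr0 ?exprn_ge0// ?ltW
    ?max_len_gt0//.
  apply/seteqP; split => // y [/(pull_sub I01)] /=;
    rewrite !in_itv/= => /andP[h _] /lt_trans /(_ h).
  by rewrite ltxx.
have [->|x1] := eqVneq x 1.
  rewrite mulr1 setIidl.
    have [_ _ ->] := iter_pull n.+1 mA A01.
    by rewrite subrr normr0 exprn_ge0// ltW// max_len_gt0.
  by move=> y /(pull_sub I01) /=; rewrite !in_itv/= => /andP[].
have xoo : 0 < x < 1.
  by case/andP: x01 => h1 h2; rewrite !lt_neqAle h1 h2 x1 eq_sym x0.
have [j xj] := ex_digit_co xoo.
rewrite (pull_lt_decomp mI I01 xj) uI.
(* Writing [x] as [branch j (branch_inv j x)] makes the terms in [a j.+1] cancel. *)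
have -> : P A * x = a j.+1 * P A + len j * (P A * branch_inv j x).
  by rewrite -[in LHS](branch_invK j x) /branch; ring.
rewrite opprD addrACA subrr add0r -mulrBr normrM (gtr0_norm (len_gt0 _)) exprS.
apply: ler_pM => //; [exact/ltW/len_gt0|exact: len_le|apply: IH].
move: xj; rewrite -branch0 -branch1 -[x in _ <= x < _](branch_invK j x)
  branch_le branch_lt.
by move=> /andP[-> /ltW ->].
Qed.

(** * Mixing of Lebesgue measure *)

Definition mixes A E := P (iter n pull A `&` E) @[n --> \oo] --> P A * P E.

(** For fixed [A], the sets [E] with this property form a Dynkin system. The rays ]-oo, x[ are
    stable under intersection, generate the Borel sets, and are handled by [mixing_lt]. *)
Lemma mixesP A E : borel A -> A `<=` oo01 -> borel E -> mixes A E.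
Proof.
move=> mA A01.
have mIt n : borel (iter n pull A) by have [] := iter_pull n mA A01.
have mixC S : borel S -> mixes A S -> mixes A (~` S).
  move=> mS mixS; rewrite /mixes.
  have -> : P A * P (~` S) = P A - P A * P S.
    rewrite -setTD fine_probabilityD// probability_setT/=; ring.
  have -> : (fun n => P (iter n pull A `&` ~` S)) =
      fun n => P A - P (iter n pull A `&` S).
    apply/funext => n; rewrite -[_ `&` ~` _]setDE -[_ `\` _]set0U.
    rewrite -(setDv (iter n pull A)) -setDIr fine_probabilityD//.
    - by have [_ _ ->] := iter_pull n mA A01.
    - exact: measurableI.
  by apply: cvgB; [exact: cvg_cst|].
have mixU S S' : borel S -> borel S' ->
    S `&` S' = set0 -> mixes A S -> mixes A S' -> mixes A (S `|` S').
  move=> mS mS' dS hS hS'; rewrite /mixes fine_probabilityU// mulrDr.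
  have -> : (fun n => P (iter n pull A `&` (S `|` S'))) =
      fun n => P (iter n pull A `&` S) + P (iter n pull A `&` S').
    apply/funext => n; rewrite setIUr fine_probabilityU//.
    - exact: measurableI.
    - exact: measurableI.
    - by rewrite setIACA dS setI0.
  exact: cvgD.
have mix0 : mixes A set0.
  rewrite /mixes measure0 mulr0; under eq_fun do rewrite setI0 measure0.
  exact: cvg_cst.
have mixT : mixes A setT by rewrite -setC0; exact: mixC.
have genE : @measurable _ (measurableTypeR R) = <<s @RGenInftyO.G R >>.
  exact: RGenInftyO.measurableE.
rewrite genE; apply: dynkin_induction => //.
- move=> _ _ [x ->] [y ->]; exists (Num.min x y).
  by apply/seteqP; split => z /=; rewrite !in_itv/= lt_min => /andP.
- move=> _ [x ->].
  (* For x < 0 the ray misses ]0, 1[ and for x > 1 it contains it; [mixing_lt] covers the rest. *)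
  have [x0|x0] := ltP x 0.
    rewrite /mixes.
    have h0 n : unif (iter n pull A `&` `]-oo, x[%classic) = 0%E.
      rewrite (_ : _ `&` _ = set0) ?measure0//; apply/seteqP; split => // y [].
      have [_ h _] := iter_pull n mA A01; move=> /h /=; rewrite !in_itv/=; lra.
    have -> : P `]-oo, x[%classic = 0.
      rewrite unifE// (_ : _ `&` _ = set0) ?measure0//; apply/seteqP;
        split => // y [] /=.
      rewrite !in_itv/=; lra.
    by rewrite mulr0; under eq_fun do rewrite h0; exact: cvg_cst.
  have [x1|x1] := leP x 1; last first.
    rewrite /mixes.
    have h0 n : unif (iter n pull A `&` `]-oo, x[%classic) = unif A.
      have [_ h <-] := iter_pull n mA A01; congr (unif _); apply: setIidl.
      by move=> y /h /=; rewrite !in_itv/=; lra.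
    have -> : P `]-oo, x[%classic = 1.
      rewrite unifE// setIidr ?lebesgue_measure_itv/= ?lte_fin ?ltr01 -?EFinB
        ?subr0//.
      by move=> y /=; rewrite !in_itv/=; lra.
    by rewrite mulr1; under eq_fun do rewrite h0; exact: cvg_cst.
  rewrite /mixes unif_lt ?x0//=.
  apply/cvgrPdist_le => e e0.
  have l1 : `|max_len| < 1 by rewrite gtr0_norm ?max_len_gt0// max_len_lt1.
  have [N _ hN] := cvgr_lt _ (cvg_expr l1) _ e0.
  exists N => // n /hN /= hn; rewrite distrC.
  by apply: le_trans (mixing_lt n mA A01 _) (ltW hn); rewrite x0.
- move=> F mF tF hF.
  have {}mF n : borel (F n) by exact: mF.
  (* Finite disjoint unions mix by additivity, and [G N] exhausts the countable union from
     inside. *)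
  pose G N : set (measurableTypeR R) := \big[setU/set0]_(i < N) F i.
  have mG N : measurable (G N) by apply: bigsetU_measurable => i _; exact: mF.
  have hG N : mixes A (G N).
    elim: N => [|N IH]; rewrite /G; first by rewrite big_ord0.
    rewrite big_ord_recr/=; apply: mixU => //; first exact: mG.
    rewrite -bigcup_mkord; apply/seteqP; split => // y [[k /= kN Fk] FN].
    by move: kN; rewrite (tF k N I I) ?ltnn//; exists y.
  pose U : set (measurableTypeR R) := (\bigcup_k F k)%classic; rewrite -/U.
  have mU : measurable U by apply: bigcup_measurable.
  have GU N : G N `<=` U by rewrite /G; apply: bigsetU_bigcup.
  have cG : P (G n) @[n --> \oo] --> P U.
    have UE : U = (\bigcup_n G n)%classic.
      apply/seteqP; split => [y [k _ Fk]|y [n _ /GU//]].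
      by exists k.+1 => //; rewrite /G -bigcup_mkord; exists k => /=.
    apply: fine_cvg; rewrite probability_fineK// UE.
    apply: nondecreasing_cvg_mu => [||]; [exact: mG|by rewrite -UE|].
    by apply/nondecreasing_seqP => n; rewrite /G big_ord_recr/= subsetEset;
      exact: subsetUl.
  apply/cvgrPdist_le => e e0.
  (* One third bounds the discrepancy on [G N]. The tail of [U] outside [G N] has mass at most a
     third, which bounds both its part in [I] and its mass times [P A]. *)
  have e3 : 0 < e / 3 by rewrite divr_gt0.
  move/cvgrPdist_le : (cG) => /(_ _ e3) [N _ hN].
  move/cvgrPdist_le : (hG N) => /(_ _ e3) [M _ hM].
  exists M => // n /hM /= hn.
  have {}hN := hN N (leqnn _); rewrite -fine_probabilityD// in hN.
  set I := iter n pull A in hn *.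
  have [mI0 I01 uI] := iter_pull n mA A01.
  have mIG : borel (I `&` G N) by exact: measurableI.
  have mIU : borel (I `&` U) by exact: measurableI.
  have mUG : borel (U `\` G N) by exact: measurableD.
  have mIUG : borel (I `&` (U `\` G N)) by exact: measurableI.
  have h1 : P (I `&` U) = P (I `&` G N) + P (I `&` (U `\` G N)).
    rewrite -fine_probabilityU//; last first.
      by apply/seteqP; split => // y [[_ Gy] [_ [_ /(_ Gy)]]].
    by rewrite -setIUr setDUK.
  have h2 : P (I `&` (U `\` G N)) <= P (U `\` G N).
    by apply: fine_probabilityS => // y [].
  have /andP[q1 q2] := fine_probability01 unif mA.
  have /andP[q3 q4] := fine_probability01 unif mUG.
  have /andP[q5 q6] := fine_probability01 unif mIUG.
  have h3 : P U = P (G N) + P (U `\` G N).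
    by rewrite fine_probabilityD// addrC subrK.
  have h4 : 0 <= P A * P (U `\` G N) <= P (U `\` G N).
    by rewrite mulr_ge0//= ler_piMl.
  rewrite ger0_norm// in hN; rewrite h1 h3 mulrDr; move: hn;
    rewrite !ler_norml; lra.
Qed.

(** * Invariance of Lebesgue measure *)

Lemma preimage_branch_map (A : set R) : A `<=` oo01 ->
  `[0, 1]%classic `&` branch_map @^-1` A = pull A.
Proof.
move=> A01; apply/seteqP; split => [x [/= x01 Ax]|x [i _ /= Ax]].
  (* Since [A] avoids 0 and 1, [x] is neither of the fixed endpoints and therefore has a digit. *)
  have h : 0 < branch_map x < 1 by have := A01 _ Ax; rewrite /= in_itv.
  have xoo : 0 < x < 1.
    have n0 : x != 0.
      by apply/eqP => e; move: h; rewrite /branch_map e eqxx ltxx.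
    have n1 : x != 1.
      by apply/eqP => e; move: h; rewrite /branch_map e eqxx orbT ltxx andbF.
    by move: x01; rewrite in_itv/= !lt_neqAle n1 eq_sym n0.
  have [i hi] := ex_digit_co xoo.
  by exists i => //=; rewrite -(branch_map_digit xoo hi).
have := pull_sub A01 (ex_intro2 _ _ i I Ax).
rewrite /= !in_itv/= => /andP[x0 x1].
split; first by rewrite !ltW.
have /andP[y0 y1] : 0 < branch_inv i x < 1.
  by have := A01 _ Ax; rewrite /= in_itv.
by rewrite -[x](branch_invK i) branch_mapK ?(ltW y0).
Qed.

(** The exceptional points form a countable set: index 0 stands for the point 0, and index [m.+1]
    for the breakpoint [a m], with [a 0 = 1]. *)
Lemma branch_map_preimage_oo x : 0 <= x <= 1 -> ~ (0 < branch_map x < 1) ->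
  range (fun n => if n is m.+1 then a m else 0) x.
Proof.
move=> /andP[x0 x1] h.
have [->|n0] := eqVneq x 0; first by exists 0%N.
have [->|n1] := eqVneq x 1; first by exists 1%N.
have xoo : 0 < x < 1 by rewrite !lt_neqAle x0 x1 n1 eq_sym n0.
have [i hi] := ex_digit_co xoo; exists i.+2 => //.
have : 0 <= branch_inv i x < 1.
  by rewrite -(branch_le i 0) -(branch_lt i _ 1) branch_invK branch0 branch1.
move: h; rewrite (branch_map_digit xoo hi) => h /andP[y0 y1].
have y00 : branch_inv i x = 0.
  by apply/eqP; apply/negPn/negP => hn; apply: h;
    rewrite lt_neqAle eq_sym hn y0.
by rewrite -branch0 -y00 branch_invK.
Qed.

Lemma unif_oo A : borel A -> unif (A `&` oo01) = unif A.
Proof. by move=> mA; rewrite !unifE -?setIA ?setIid//; exact: measurableI. Qed.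

(** Up to points of the countable set [Z], the preimage of [A] is the pullback of its part in ]0,
    1[. *)
Lemma acip_unif : acip branch_map unif.
Proof.
split.
- rewrite unifE// setIidr; last exact: subset_itvW.
  by rewrite lebesgue_measure_itv/= lte_fin ltr01 -EFinB subr0.
- exact: dominates_uniform_prob.
move=> A mA; pose A' := A `&` oo01.
have mA' : borel A' by exact: measurableI.
have A'01 : A' `<=` oo01 by move=> x [].
pose Z : set R := range (fun n => if n is m.+1 then a m else 0).
have cZ : countable Z.
  by apply: card_le_trans (card_image_le _ _) _; exact: countableP.
set X := _ `&` _.
have mXZ : borel (X `&` Z).
  apply: countable_measurable; first by move=> t; exact: measurable_set1.
  by apply: sub_countable cZ; apply: subset_card_le => x [].
have XE : X = pull A' `|` (X `&` Z).
  rewrite -(preimage_branch_map A'01); apply/seteqP; split => x /=.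
    move=> [x01 Ax]; have [h|h] := pselect (0 < branch_map x < 1).
      by left; split => //; split => //=; rewrite in_itv.
    by right; split => //; apply: branch_map_preimage_oo.
  by move=> [[x01 []]|[]].
have nXZ : unif (X `&` Z) = 0%E.
  rewrite unifE//; apply: countable_lebesgue_measure0.
  by apply: sub_countable cZ; apply: subset_card_le => x [[]].
rewrite XE (measureU0 _ _ nXZ)//; last exact: measurable_pull.
by rewrite -(unif_oo mA) -/A' -unif_pull.
Qed.

(** * Uniqueness of the absolutely continuous invariant probability *)

Section unique.
Variable nu : probability (measurableTypeR R) R.
Hypothesis acip_nu : acip branch_map nu.

(** Absolute continuity makes the endpoints null for [nu], which charges only [0, 1]. *)
Lemma acip_oo A : borel A -> nu (A `&` oo01) = nu A.
Proof.
move=> mA; case: acip_nu => nu01 /null_content_dominatesP nuleb _.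
have m2 : borel ([set 0; 1]%classic).
  by apply: measurableU; exact: measurable_set1.
have n2 : nu [set 0; 1]%classic = 0%E.
  by apply: nuleb => //; apply: countable_lebesgue_measure0;
    exact/finite_set_countable.
have nC : nu (~` oo01) = 0%E.
  have nC : nu (~` `[0, 1]%classic) = 0%E.
    by rewrite probability_setC// nu01 subee.
  apply/eqP; rewrite eq_le measure_ge0 andbT -[leRHS]adde0 -[X in (X + _)%E]nC
    -[X in (_ + X)%E]n2.
  apply: le_trans (measureU2 _ _ _); [|exact: measurableC|exact: m2].
  apply: le_measure; rewrite ?inE.
  - exact: measurableC.
  - by apply: measurableU => //; exact: measurableC.
  move=> x /=; rewrite !in_itv/= => h.
  have [->|n0] := eqVneq x 0; first by right; left.
  have [->|n1] := eqVneq x 1; first by right; right.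
  by left; apply: contra_not h => /andP[h1 h2];
    rewrite !lt_neqAle h1 h2 n1 eq_sym n0.
have mAI : borel (A `&` oo01) by exact: measurableI.
have mAD : borel (A `\` oo01) by exact: measurableD.
have nD : nu (A `\` oo01) = 0%E.
  apply/eqP; rewrite eq_le measure_ge0 andbT -nC.
  by apply: le_measure; rewrite ?inE; [|exact: measurableC|move=> x []].
have E (J : set (measurableTypeR R)) : measurable J ->
  nu A = (nu (A `\` J) + nu (A `&` J))%E.
  exact: measureDI.
by rewrite (E oo01)// nD add0e.
Qed.

Lemma acip_iter_pull A n :
  borel A -> A `<=` oo01 -> nu (iter n pull A) = nu A.
Proof.
move=> mA A01; case: acip_nu => _ _ inv; elim: n => // n IH.
have [mI I01 _] := iter_pull n mA A01.
by rewrite -IH -(inv _ mI) (preimage_branch_map I01).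
Qed.

(** The density is to be taken with respect to [unif], for which mixing has been proved. *)
Lemma acip_dominated : nu `<< unif.
Proof.
apply/null_content_dominatesP => A mA.
case: acip_nu => nu01 /null_content_dominatesP nuleb _.
move=> h; have {}h : unif A = 0%E := h.
rewrite unifE// in h; rewrite -acip_oo//; apply: nuleb => //;
  exact: measurableI.
Qed.

Import HBNNSimple.

(** A simple function is a finite combination of indicators of its fibres, and [mixesP] applies to
    each fibre. *)
Lemma integral_nnsfun_mixes A (h : {nnsfun (measurableTypeR R) >-> R}) :
  borel A -> A `<=` oo01 ->
  (\int[unif]_(x in iter n pull A) (h x)%:E @[n --> \oo]
    --> unif A * sintegral unif h)%E.
Proof.
move=> mA A01.
have mIt n : borel (iter n pull A) by have [] := iter_pull n mA A01.
set vals := fset_set (range h).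
have intE n : (\int[unif]_(x in iter n pull A) (h x)%:E =
  (\sum_(y <- vals) y * P (iter n pull A `&` h @^-1` [set y]))%:E)%E.
  under eq_integral do rewrite fimfunE -fsumEFin//.
  rewrite ge0_integral_fsum//; last 2 first.
  - by move=> y; exact/measurable_EFinP/measurable_funM.
  - by move=> y x _; rewrite nnfun_muleindic_ge0.
  rewrite fsbig_finite//= -sumEFin; apply: eq_bigr => y _.
  rewrite integralZl_indic_nnsfun// integral_indic// EFinM setIC fineK//.
  by apply: fin_num_measure; exact: measurableI.
rewrite (_ : (fun n => _) =
    fun n => (\sum_(y <- vals) y * P (iter n pull A `&` h @^-1` [set y]))%:E);
  last exact/funext.
rewrite sintegralE fsbig_finite//=.
have -> : (unif A * (\sum_(y <- vals) y%:E * unif (h @^-1` [set y])) =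
    (\sum_(y <- vals) y * (P A * P (h @^-1` [set y])))%:E)%E.
  have -> : (\sum_(y <- vals) y%:E * unif (h @^-1` [set y]) =
      (\sum_(y <- vals) y * P (h @^-1` [set y]))%:E)%E.
    by rewrite -sumEFin; apply: eq_bigr => y _; rewrite EFinM probability_fineK.
  rewrite -(probability_fineK unif mA) -EFinM mulr_sumr; congr EFin;
    apply: eq_bigr => y _; ring.
apply: cvg_EFin; first exact: nearW.
apply: cvg_big => [|y _]; first exact: add_continuous.
by apply: cvgMr; exact: mixesP.
Qed.

Lemma acip_ge_unif A : borel A -> (unif A <= nu A)%E.
Proof.
wlog A01 : A / A `<=` oo01 => [hw mA|mA].
  by rewrite -unif_oo// -acip_oo//; apply: hw; [move=> x []|exact: measurableI].
have [f [f0 intf fE]] := radon_nikodym_finite acip_dominated.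
have mf : measurable_fun setT f by exact: measurable_int intf.
pose h := nnsfun_approx measurableT mf.
have hf n x : ((h n x)%:E <= f x)%E.
  have nd : nondecreasing_seq (fun n => (h n x)%:E).
    move=> m k mk; rewrite lee_fin;
      have /lefP := nd_nnsfun_approx measurableT mf mk; exact.
  have cv : (h n x)%:E @[n --> \oo] --> f x by apply: cvg_nnsfun_approx.
  rewrite -(cvg_lim _ cv)//.
  apply: lime_ge; first by apply/cvg_ex; exists (f x).
  by exists n => // m; exact: nd.
(* By invariance [nu A] is the integral of [f] over [iter n pull A] for every [n], hence at least
   that of [h k]; then [n] tends to infinity. *)
have step k : (unif A * sintegral unif (h k) <= nu A)%E.
  rewrite -(cvg_lim _ (@integral_nnsfun_mixes _ (h k) mA A01))//.
  apply: lime_le; first by apply/cvg_ex; eexists;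
    exact: (@integral_nnsfun_mixes _ (h k) mA A01).
  apply: nearW => n; rewrite -(acip_iter_pull n mA A01).
  have [mI _ _] := iter_pull n mA A01.
  rewrite fE//; apply: ge0_le_integral => //.
  - by move=> x _; rewrite lee_fin.
  - by apply/measurable_EFinP; exact: measurable_funTS.
  - exact: measurable_funTS.
(* By monotone convergence the integrals of [h k] tend to that of [f], which is [nu setT = 1]. *)
have cv : (unif A * sintegral unif (h k))%E @[k --> \oo] --> unif A.
  rewrite -[X in _ --> X]mule1 -(probability_setT nu) fE//.
  apply: cvgeZl; first exact: fin_num_measure.
  have nd x : nondecreasing_seq (h ^~ x).
    by move=> m n mn; have /lefP := nd_nnsfun_approx measurableT mf mn.
  rewrite (@nd_ge0_integral_lim _ _ _ unif f h)//.
    exact: is_cvg_sintegral.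
  by move=> x; apply: cvg_nnsfun_approx.
rewrite -[leLHS](cvg_lim _ cv)//.
apply: lime_le; first by apply/cvg_ex; exists (unif A).
by apply: nearW => k.
Qed.

End unique.

Lemma the_acip_unif : the_acip branch_map unif.
Proof.
split=> [|nu acip_nu A mA]; first exact: acip_unif.
apply/eqP; rewrite eq_le acip_ge_unif// andbT.
have := acip_ge_unif acip_nu (measurableC mA).
rewrite !probability_setC//.
rewrite -(probability_fineK unif mA) -[nu A]fineK ?fin_num_measure// -!EFinB
  !lee_fin; lra.
Qed.

(** * Entropy of Lebesgue measure *)

(** The coded image is some ]u, v] while [unifE] intersects with ]0,
    1[, which may remove v; squeezing between ]u, v[ and ]u, v] settles this. *)
Lemma unif_cylinder n (w : n.-tuple nat) :
  unif (coding branch @` cylinder w) = (word_len w)%:E.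
Proof.
rewrite coding_cylinder unifE// -branch_comp_len.
have u01 : branch_comp branch w 0 < branch_comp branch w 1.
  by rewrite -subr_gt0 branch_comp_len word_len_gt0.
have /andP[u0 _] := branch_comp0_range w.
have /andP[_ u1] : 0 <= branch_comp branch w 1 <= 1.
  by apply: branch_comp_range; rewrite lexx ler01.
move: (branch_comp branch w 0) (branch_comp branch w 1) u01 u0 u1 => u v uv u0 v1.
apply/eqP; rewrite eq_le; apply/andP; split.
  apply: (@le_trans _ _ (leb `]u, v]%classic)).
    by apply: le_measure; rewrite ?inE//; exact: measurableI.
  by rewrite lebesgue_measure_itv/= lte_fin uv -EFinB.
apply: (@le_trans _ _ (leb `]u, v[%classic)).
  by rewrite lebesgue_measure_itv/= lte_fin uv -EFinB.
apply: le_measure; rewrite ?inE//; first exact: measurableI.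
move=> x /=; rewrite !in_itv/= => /andP[ux xv]; rewrite ux (ltW xv); split => //.
by rewrite (le_lt_trans u0)// (lt_le_trans xv).
Qed.

(** The lengths of the letters sum to 1. The factor [c] is there for the induction, where it absorbs
    the length of the first letter. *)
Lemma esum_word_len n c : 0 <= c ->
  (\esum_(w in [set: n.-tuple nat]) (c * word_len w)%:E = c%:E)%E.
Proof.
elim: n c => [|n IH] c c0.
  rewrite (_ : [set: 0.-tuple nat]%classic = [set [tuple]]%classic); last first.
    by apply/seteqP; split => // w _; rewrite /= tuple0.
  by rewrite esum_set1 ?mulr1// lee_fin mulr_ge0.
rewrite esum_tupleS; last first.
  by move=> w; rewrite lee_fin mulr_ge0// ltW// word_len_gt0.
under eq_eseriesr => i _.
  rewrite (eq_esum (b := fun w : n.-tuple nat =>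
    (c * len i * word_len w)%:E)); last first.
    by move=> w _; rewrite /= mulrA.
  rewrite IH; last by rewrite mulr_ge0// ltW// len_gt0.
  rewrite EFinM.
  over.
rewrite /= nneseriesZl; last by move=> i _; rewrite lee_fin ltW// len_gt0.
by rewrite (series_len 0) a_0 mule1.
Qed.

Lemma word_len_le1 w : word_len w <= 1.
Proof.
elim: w => //= i w IH; rewrite mulr_ile1//;
  [exact/ltW/len_gt0|exact/ltW/word_len_gt0|].
exact: le_trans (len_le i) (ltW max_len_lt1).
Qed.

Lemma len_le1 i : len i <= 1.
Proof. exact: le_trans (len_le i) (ltW max_len_lt1). Qed.

Definition branch_entropy : \bar R :=
  (\sum_(i <oo) (entropy_term (len i))%:E)%E.

(** Letters are independent and identically distributed under [unif], so each one adds the same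
    entropy. The identity is in the extended reals, which covers infinite entropy. *)
Lemma partition_entropyE n :
  partition_entropy branch unif n = (n%:R%:E * branch_entropy)%E.
Proof.
rewrite /partition_entropy.
under eq_esum do rewrite unif_cylinder /=.
have t0 w : 0 <= entropy_term (word_len w).
  by apply: entropy_term_ge0; rewrite word_len_gt0 word_len_le1.
elim: n => [|n IH].
  rewrite mul0e; apply: esum1 => w _;
    rewrite tuple0 /entropy_term/= ln1 mulr0//.
rewrite esum_tupleS; last by move=> w; rewrite lee_fin.
have l0 i := len_gt0 i.
have h0 i : 0 <= entropy_term (len i).
  by apply: entropy_term_ge0; rewrite l0 len_le1.
(* The logarithm of the product splits; each summand is then summed first over the index whose
   lengths add up to 1. *)
have split_term i (w : n.-tuple nat) :
    ((entropy_term (word_len [tuple of i :: w]))%:E =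
     (entropy_term (len i) * word_len w)%:E +
     (entropy_term (word_len w) * len i)%:E)%E.
  rewrite -EFinD; congr EFin; rewrite /entropy_term /= lnM ?posrE
    ?word_len_gt0//; ring.
under eq_eseriesr => i _.
  under eq_esum => w _ do rewrite split_term.
  rewrite esumD; last 2 first.
  - by move=> w _; rewrite lee_fin mulr_ge0// ltW// word_len_gt0.
  - by move=> w _; rewrite lee_fin mulr_ge0// ltW.
  rewrite esum_word_len//.
  over.
rewrite nneseriesD; last 2 first.
- by move=> i _; rewrite lee_fin.
- by move=> i _ _; apply: esum_ge0 => w _; rewrite lee_fin mulr_ge0// ltW.
have -> : (\sum_(i <oo) \esum_(w in [set: n.-tuple nat])
    (entropy_term (word_len w) * len i)%:E =
  \esum_(w in [set: n.-tuple nat]) (entropy_term (word_len w))%:E)%E.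
  rewrite nneseries_esumT; last by move=> i; apply: esum_ge0 => w _;
    rewrite lee_fin mulr_ge0// ltW.
  rewrite exchange_esumT; last by move=> i w; rewrite lee_fin mulr_ge0// ltW.
  apply: eq_esum => w _.
  rewrite -nneseries_esumT; last by move=> i; rewrite lee_fin mulr_ge0// ltW.
  under eq_eseriesr do rewrite EFinM.
  rewrite nneseriesZl; last by move=> i _; rewrite lee_fin ltW.
  by rewrite (series_len 0) a_0 mule1.
rewrite IH -/branch_entropy -[in RHS]natr1 EFinD ge0_muleDl ?lee_fin// mul1e
  addeC//.
Qed.

Lemma entropyE : entropy branch unif = branch_entropy.
Proof.
apply/cvg_lim => //; apply: cvg_near_cst.
exists 1%N => // n /= n1; rewrite partition_entropyE muleA -EFinM mulVf
  ?mul1e//.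
by rewrite pnatr_eq0 -lt0n.
Qed.

End affine_markov_map.

(** * The two families of partitions *)

Section examples.
Context {R : realType}.
Implicit Types i j k n : nat.

Definition dyadic i : R := 2^-1 ^+ i.

(** The factor [2 ^ k] in the exponent offsets the mass 2^-k of the interval being split, so that
    the entropy gained grows linearly in [k]. *)
Definition spread k : nat := 2 ^ (k * 2 ^ k).

(* The points of dyadic up to 2^-k, followed by the rescaled harmonic-like
   points 2^-k * N / (N + j) with N = spread k: the first N of the corresponding
   intervals have lengths comparable to 2^-k / N, hence contribute at least
   2^-k * ln N / 4 = k * ln 2 / 4 to the entropy. *)
Definition dyadic_spread k i : R :=
  2^-1 ^+ minn i k * ((spread k)%:R / (spread k + (i - k))%:R).

Lemma spread_gt0 k : (0 < spread k)%N.
Proof. by rewrite expn_gt0. Qed.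

Lemma dyadic0 : dyadic 0 = 1.
Proof. by rewrite /dyadic expr0. Qed.

Lemma dyadic_len i : len dyadic i = 2^-1 ^+ i.+1.
Proof. rewrite /len /dyadic exprS; lra. Qed.

Lemma dyadic_decr i : dyadic i.+1 < dyadic i.
Proof. by rewrite -subr_gt0 -/(len dyadic i) dyadic_len exprn_gt0// invr_gt0.
  Qed.

Lemma dyadic_cvg0 : dyadic i @[i --> \oo] --> (0 : R).
Proof. by apply: cvg_expr; rewrite gtr0_norm; lra. Qed.

Lemma dyadic_spread_le k i : (i <= k)%N -> dyadic_spread k i = dyadic i.
Proof.
move=> ik; rewrite /dyadic_spread (minn_idPl ik) (eqP ik : (i - k)%N = 0%N)
  addn0.
by rewrite divff ?mulr1// pnatr_eq0 -lt0n spread_gt0.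
Qed.

Lemma dyadic_spread_add k j : dyadic_spread k (k + j) =
  2^-1 ^+ k * ((spread k)%:R / ((spread k)%:R + j%:R)).
Proof. by rewrite /dyadic_spread (minn_idPr (leq_addr _ _)) addKn natrD. Qed.

Lemma dyadic_spread_len_add k j : len (dyadic_spread k) (k + j) =
  2^-1 ^+ k * ((spread k)%:R / (((spread k)%:R + j%:R) * ((spread k)%:R + j%:R
    + 1))).
Proof.
rewrite /len -addnS !dyadic_spread_add -natr1.
have : (0:R) < (spread k)%:R by rewrite ltr0n spread_gt0.
have : (0:R) <= j%:R by [].
move=> j0 s0; field.
by rewrite !gt_eqF//; lra.
Qed.

Lemma dyadic_spread0 k : dyadic_spread k 0 = 1.
Proof. by rewrite dyadic_spread_le// dyadic0. Qed.

Lemma dyadic_spread_decr k i : dyadic_spread k i.+1 < dyadic_spread k i.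
Proof.
have [ik|ki] := ltnP i k.
  by rewrite !dyadic_spread_le ?(ltnW ik)// dyadic_decr.
rewrite -subr_gt0 -/(len (dyadic_spread k) i) -(subnKC ki)
  dyadic_spread_len_add.
have s0 : (0:R) < (spread k)%:R by rewrite ltr0n spread_gt0.
by rewrite mulr_gt0 ?exprn_gt0 ?invr_gt0// divr_gt0// mulr_gt0 ?ltr_pwDl//
  ltr_wpDr.
Qed.

Lemma dyadic_spread_cvg0 k : dyadic_spread k i @[i --> \oo] --> (0 : R).
Proof.
have s0 : (0:R) < (spread k)%:R by rewrite ltr0n spread_gt0.
rewrite -(cvg_shiftn k) /=.
under eq_fun do rewrite addnC dyadic_spread_add.
suff h : (((spread k)%:R + j%:R)^-1)%R @[j --> \oo] --> (0 : R).
  suff : 2^-1 ^+ k * ((spread k)%:R / ((spread k)%:R + j%:R)) @[j --> \oo] -->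
      (2^-1 ^+ k * ((spread k)%:R * 0) : R) by rewrite !mulr0.
  by apply: cvgMr; exact: cvgMr.
(* As [spread k] is at least 1, the sequence lies below 1 / (j + 1). *)
apply: (@squeeze_cvgr _ _ _ _ (cst 0) harmonic);
  [|exact: cvg_cst|exact: cvg_harmonic].
apply: nearW => j /=; rewrite invr_ge0 addr_ge0//= lef_pV2 ?posrE//;
  last by rewrite ltr_pwDl.
by rewrite -natr1 addrC lerD2r ler1n spread_gt0.
Qed.

Lemma dyadic_spread_cvg i : dyadic_spread k i @[k --> \oo] --> dyadic i.
Proof.
by apply: cvg_near_cst; exists i => // k /= ik; exact: dyadic_spread_le.
Qed.

(** The entropy is ln 2 times the sum of the (i + 1) 2^-(i + 1); the closed form of the partial sums
    bounds the latter by 2. *)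
Lemma dyadic_entropy_lty : (branch_entropy dyadic < +oo)%E.
Proof.
apply: (@le_lt_trans _ _ (2 * ln 2)%:E); last exact: ltry.
have l2 : 0 < ln (2 : R) by rewrite ln_gt0// ltr1n.
have E i : entropy_term (len dyadic i) = ln 2 * (i.+1%:R * 2^-1 ^+ i.+1).
  rewrite dyadic_len /entropy_term lnXn ?invr_gt0// lnV ?posrE// -mulr_natl;
    ring.
apply: nneseries_le => [i|n].
  by rewrite E mulr_ge0 ?(ltW l2)// mulr_ge0// exprn_ge0// invr_ge0.
under eq_bigr do rewrite E.
rewrite -mulr_sumr mulrC ler_pM2r//.
suff -> : \sum_(0 <= i < n) (i.+1%:R * 2^-1 ^+ i.+1) =
    2 - (n%:R + 2) * 2^-1 ^+ n :> R.
  by rewrite gerDl oppr_le0 mulr_ge0 ?addr_ge0// exprn_ge0// invr_ge0.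
elim: n => [|n IH]; first by rewrite big_geq// expr0; ring.
by rewrite big_nat_recr//= IH exprS -natr1; field.
Qed.

(** With exponent 1/2 the lengths become a geometric sequence of ratio 2^(-1/2). *)
Lemma dyadic_length_summable :
  (\sum_(0 <= i <oo) (branch_length (branch dyadic) i `^ (2^-1 : R)) < +oo)%E.
Proof.
pose r : R := 2^-1 `^ 2^-1.
have r0 : 0 < r by rewrite powR_gt0// invr_gt0.
have r1 : r < 1.
  by rewrite /r powR12_sqrt ?invr_ge0// -[ltRHS]sqrtr1 ltr_sqrt//; lra.
have E i : (branch_length (branch dyadic) i `^ 2^-1)%E = (r ^+ i.+1)%:E.
  rewrite branch_length_branch; last exact: dyadic_decr.
  rewrite poweR_EFin dyadic_len /r -!powR_mulrn ?powR_ge0 ?invr_ge0//.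
  by rewrite -!powRrM mulrC.
under eq_eseriesr do rewrite E.
apply: (@le_lt_trans _ _ (r / (1 - r))%:E); last exact: ltry.
apply: nneseries_le => [i|n]; first by rewrite exprn_ge0// ltW.
have -> : \sum_(0 <= i < n) r ^+ i.+1 = r / (1 - r) * (1 - r ^+ n).
  elim: n => [|n IH]; first by rewrite big_geq// expr0; ring.
  by rewrite big_nat_recr//= IH exprS; field; rewrite subr_eq0 gt_eqF.
rewrite ler_piMr ?divr_ge0 ?subr_ge0 ?(ltW r0) ?(ltW r1)//.
by rewrite gerDl oppr_le0 exprn_ge0// ltW.
Qed.

Lemma dyadic_spread_entropy_ge k :
  ((k%:R * (ln 2 / 4))%:E <= branch_entropy (dyadic_spread k))%E.
Proof.
set N := spread k.
have s0 : (0:R) < N%:R by rewrite ltr0n spread_gt0.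
have s1 : (1:R) <= N%:R by rewrite ler1n spread_gt0.
have lN : ln (N%:R : R) = k%:R * 2 ^+ k * ln 2.
  by rewrite /N /spread natrX lnXn// -[LHS]mulr_natl natrM natrX.
have lN0 : 0 <= ln (N%:R : R) by rewrite ln_ge0.
(* The first [N] spread intervals have length at least 2^-k / (4 N), and minus the logarithm of that
   length is at least ln N. *)
pose c : R := 2^-1 ^+ k / (4 * N%:R) * ln N%:R.
have t0 i : 0 <= entropy_term (len (dyadic_spread k) i).
  apply: entropy_term_ge0.
  rewrite (len_gt0 (dyadic_spread_decr k)).
  exact: (len_le1 (dyadic_spread0 k) (dyadic_spread_decr k)
    (dyadic_spread_cvg0 k)).
have h j : (j < N)%N -> c <= entropy_term (len (dyadic_spread k) (k + j)).
  move=> jN; rewrite dyadic_spread_len_add -/N /entropy_term.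
  have j0 : (0:R) <= j%:R by [].
  have jN' : j%:R + 1 <= N%:R :> R by rewrite natr1 ler_nat.
  set q := N%:R / _; have q0 : 0 < q by rewrite divr_gt0// mulr_gt0; lra.
  have e0 : 0 < 2^-1 ^+ k :> R by rewrite exprn_gt0// invr_gt0.
  have e1 : 2^-1 ^+ k <= 1 :> R by rewrite exprn_ile1 ?invr_ge0//; lra.
  have d0 : 0 < (N%:R + j%:R) * (N%:R + j%:R + 1) :> R by rewrite mulr_gt0; lra.
  (* For [j < N] the denominator of [q] lies between N^2 and (2 N)^2. *)
  have q1 : 1 / (4 * N%:R) <= q.
    rewrite /q ler_pdivlMr// mulrAC ler_pdivrMr ?mulr_gt0//; nra.
  have q2 : q <= 1 / N%:R.
    rewrite /q ler_pdivrMr// mulrAC ler_pdivlMr//; nra.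
  rewrite !div1r in q1 q2.
  have lq : ln N%:R <= - ln (2^-1 ^+ k * q).
    rewrite lerNr -lnV ?posrE// ler_ln ?posrE ?mulr_gt0 ?invr_gt0//.
    by rewrite (le_trans _ q2)// ler_piMl// ltW.
  rewrite mulNr -mulrN /c (@le_trans _ _ (2^-1 ^+ k * q * ln N%:R))//.
    by rewrite ler_wpM2r// ler_pM2l.
  by rewrite ler_wpM2l// ltW// mulr_gt0.
(* Here N c = 2^-k ln N / 4, and ln N = k 2^k ln 2. *)
have -> : k%:R * (ln 2 / 4) = \sum_(0 <= j < N) c :> R.
  rewrite sumr_const_nat subn0 -mulr_natl /c lN exprVn.
  by field; rewrite gt_eqF//= expf_neq0.
(* The first [k] terms and those from [k + N] on are nonnegative and dropped. *)
apply: (@le_trans _ _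
    (\sum_(0 <= i < k + N) entropy_term (len (dyadic_spread k) i))%:E).
  rewrite lee_fin [leRHS](big_cat_nat (n := k))//= ?leq_addr//.
  rewrite -[leLHS]add0r lerD// ?sumr_ge0//.
  rewrite -{1}[k]add0n big_addn addKn.
  rewrite !big_mkord; apply: ler_sum => j _; rewrite addnC; exact: h.
rewrite -sumEFin; apply: nneseries_lim_ge => i _ _; rewrite lee_fin//.
Qed.

Lemma dyadic_spread_entropy_cvg :
  (branch_entropy (dyadic_spread k) @[k --> \oo] --> +oo)%E.
Proof.
have l2 : 0 < ln (2 : R) by rewrite ln_gt0// ltr1n.
apply/cvgeyPge => A.
near=> k.
apply: le_trans (dyadic_spread_entropy_ge k).
rewrite lee_fin -ler_pdivrMr ?divr_gt0//.
near: k; exact: nbhs_infty_ger.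
Unshelve. all: by end_near. Qed.

End examples.

Theorem proposition1p5 (R : realType) :
  exists (o : orientation)
         (f : nat -> R -> R) (T : R -> R)
         (fk : nat -> nat -> R -> R) (Tk : nat -> R -> R),
    [/\ countable_markov_map o f T,
        forall k, countable_markov_map o (fk k) (Tk k),
        potential_finite f &
        forall k, potential_finite (fk k)] /\
    [/\ summable_variations (potential f),
        exists t : R, [/\ 0 < t, t < 1 &
          (\sum_(0 <= i <oo) (branch_length f i `^ t) < +oo)%E],
        (ereal_sup [set sum_of_variations (potential (fk k)) | k in [set: nat]]
           < +oo)%E &
        forall i (x : R), x \in `[0, 1] -> fk k i x @[k --> \oo] --> f i x] /\
    exists (mu : probability (measurableTypeR R) R)
           (muk : nat -> probability (measurableTypeR R) R),
      [/\ the_acip T mu,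
          forall k, the_acip (Tk k) (muk k),
          (entropy f mu < +oo)%E &
          entropy (fk k) (muk k) @[k --> \oo] --> +oo%E].
Proof.
have a0 := @dyadic0 R; have ad := @dyadic_decr R; have ac := @dyadic_cvg0 R.
have b0 := @dyadic_spread0 R; have bd := @dyadic_spread_decr R.
have bc := @dyadic_spread_cvg0 R.
exists Increasing, (branch dyadic), (branch_map dyadic),
  (fun k => branch (dyadic_spread k)), (fun k => branch_map (dyadic_spread k)).
split; last split.
- split => [|k||k]; by [exact: markov_branch|exact: potential_finite_branch].
- split.
  + by rewrite /summable_variations sum_of_variations_branch// ltry.
  + exists (1 / 2); split; [lra..|]; rewrite mul1r;
    exact: dyadic_length_summable.
  + apply: (@le_lt_trans _ _ 0%E); last exact: ltry.
    by apply: ge_ereal_sup => _ [k _ <-]; rewrite sum_of_variations_branch.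
  + move=> i x _; rewrite /branch /len.
    apply: cvgD; first exact: dyadic_spread_cvg.
    apply: cvgMl; apply: cvgB; exact: dyadic_spread_cvg.
- exists unif, (fun=> unif); split.
  + exact: the_acip_unif.
  + by move=> k; exact: the_acip_unif.
  + by rewrite entropyE//; exact: dyadic_entropy_lty.
  + under eq_fun do rewrite entropyE//.
    exact: dyadic_spread_entropy_cvg.
Qed.
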